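(* Let $(M,g_0)$ be a closed Riemannian manifold equipped with a Riemannian foliation $\mathcal{F}$, with vertical bundle $\mathcal{V}$ (tangent to the leaves) and horizontal bundle $\mathcal{H}$ (the $g_0$-orthogonal complement of $\mathcal{V}$). Let $\mathbb{T}^2\subset M$ be a totally geodesic flat $2$-torus whose tangent space at each point is spanned by a horizontal vector $X$ and a vertical vector $Y$, where $X,Y$ are vector fields tangent to $\mathbb{T}^2$ with $\nabla^0_XX=\nabla^0_XY=\nabla^0_YY=0$ on $\mathbb{T}^2$. Let $f:M\to\mathbb{R}$ be a smooth basic function and consider the vertically warped metric $$g_f:=g_0|_{\mathcal{H}}+e^{2f}g_0|_{\mathcal{V}}.$$ For $t\in[0,1]$ let $g_t:=(1-t)g_0+tg_f$, with curvature tensor $R_t$, and assume that $R_0'(X,Y,Y,X):=\left.\frac{d}{dt}\right|_{t=0}R_t(X,Y,Y,X)=0$ on $\mathbb{T}^2$. Then for every integer $r\ge2$, $$\int_{\mathbb{T}^2}\left.\frac{d^r}{dt^r}\right|_{t=0}R_t(X,Y,Y,X)\,dA>0\quad\Longleftrightarrow\quad\int_{\mathbb{T}^2}e^{4f}(1-e^{2f})^{r-2}\|df(X)Y\|_{g_0}^2\,dA>0.$$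
   Context: $\nabla^0$ is the Levi-Civita connection of $g_0$, and $dA$ is the area form induced on $\mathbb{T}^2$ by $g_0$. A basic function is one that is constant on the leaves of $\mathcal{F}$. In $g_f$ the bundles $\mathcal{H}$ and $\mathcal{V}$ remain orthogonal. Curvature sign convention: $R_t(X,Y,Y,X)$ equals the $g_t$-sectional curvature of $\mathrm{span}(X,Y)$ times $g_t(X,X)g_t(Y,Y)-g_t(X,Y)^2$. Convention: $(1-e^{2f})^{0}=1$. *)

(* Defs.v *)
From HB Require Import structures.
From mathcomp Require Import all_boot all_order all_algebra.
From mathcomp Require Import all_classical all_reals all_analysis.
Set Implicit Arguments.
Unset Strict Implicit.
Unset Printing Implicit Defensive.
Import Order.TTheory GRing.Theory Num.Theory numFieldNormedType.Exports.
Local Open Scope classical_set_scope.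
Local Open Scope ring_scope.

(* Tangent vectors, metrics and curvature are handled through their components
   in charts. Vectors are rows; a metric on an open subset of R^n is a
   matrix-valued function; linear maps act on the right, so that a vector v
   is transported by a map c to v *m 'J c x. *)

Section Smooth.
Variable R : realType.

Definition partial n (i : 'I_n) (h : 'rV[R]_n -> R) (x : 'rV[R]_n) : R :=
  'D_(delta_mx 0 i) h x.

(* C^oo on the open set O: every iterated partial derivative is differentiable
   at every point of O. *)
Definition smooth_on n (O : set 'rV[R]_n) (h : 'rV[R]_n -> R) : Prop :=
  forall (s : seq 'I_n) (x : 'rV[R]_n), O x ->
    differentiable (foldr (@partial n) h s) x.

Definition smooth_map_on n m1 m2 (O : set 'rV[R]_n)
    (h : 'rV[R]_n -> 'M[R]_(m1, m2)) : Prop :=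
  forall i j, smooth_on O (fun x => h x i j).

End Smooth.

Section Coordinates.
Variables (R : realType) (n : nat).
Implicit Types (G : 'rV[R]_n -> 'M[R]_n) (g : 'M[R]_n) (x v w z : 'rV[R]_n).

Definition ip g v w : R := (v *m g *m w^T) 0 0.

(* nabla_v w for the Levi-Civita connection of G, where v and w are extended to
   constant fields. Such fields commute, so Koszul's formula reads
   2 G(nabla_v w, z) = v.G(w, z) + w.G(v, z) - z.G(v, w). *)
Definition christoffel G x v w : 'rV[R]_n :=
  2^-1 *: (\row_l ('D_v (fun y => ip (G y) w (delta_mx 0 l)) x
                 + 'D_w (fun y => ip (G y) v (delta_mx 0 l)) x
                 - 'D_(delta_mx 0 l) (fun y => ip (G y) v w) x))
  *m invmx (G x).

(* For c : R^m -> R^n, a field a on R^m and a field B along c, the covariant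
   derivative nabla_{dc(a)} B along c (the pull-back connection). *)
Definition cov m G (c : 'rV[R]_m -> 'rV[R]_n) (a : 'rV[R]_m -> 'rV[R]_m)
    (B : 'rV[R]_m -> 'rV[R]_n) (u : 'rV[R]_m) : 'rV[R]_n :=
  'D_(a u) B u + christoffel G (c u) ('D_(a u) c u) (B u).

Definition nabla G (X Y : 'rV[R]_n -> 'rV[R]_n) : 'rV[R]_n -> 'rV[R]_n :=
  cov G id X Y.

(* R(v, w, z, y) = G(nabla_v nabla_w z - nabla_w nabla_v z - nabla_[v,w] z, y),
   computed on constant extensions of v, w, z, for which [v, w] = 0. *)
Definition curv G x v w z y : R :=
  ip (G x) (nabla G (cst v) (nabla G (cst w) (cst z)) x
            - nabla G (cst w) (nabla G (cst v) (cst z)) x) y.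

End Coordinates.

Section Foliation.
Variables (R : realType) (k q : nat) (M : topologicalType).

Definition obox n (lo hi : 'rV[R]_n) : set 'rV[R]_n :=
  [set x | forall j, lo 0 j < x 0 j < hi 0 j].

(* A smooth (k + q)-manifold with a foliation by k-dimensional leaves. A
   foliated atlas carries both structures. The first k coordinates run along
   the leaves and the last q are transverse. Chart images are open boxes, so
   that plaques are connected. *)
Record foliated_atlas := FoliatedAtlas {
  chart : Type;
  chart_at : M -> chart;
  dom : chart -> set M;
  chart_map : chart -> M -> 'rV[R]_(k + q);
  chart_inv : chart -> 'rV[R]_(k + q) -> M;
  lo : chart -> 'rV[R]_(k + q);
  hi : chart -> 'rV[R]_(k + q);
  mem_chart_at : forall p, dom (chart_at p) p;
  dom_open : forall i, open (dom i);
  chart_map_box : forall i p, dom i p -> obox (lo i) (hi i) (chart_map i p);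
  chart_inv_dom : forall i x, obox (lo i) (hi i) x -> dom i (chart_inv i x);
  chart_mapK : forall i p, dom i p -> chart_inv i (chart_map i p) = p;
  chart_invK : forall i x, obox (lo i) (hi i) x -> chart_map i (chart_inv i x) = x;
  chart_map_continuous : forall i p, dom i p -> {for p, continuous (chart_map i)};
  chart_inv_continuous : forall i x, obox (lo i) (hi i) x ->
    {for x, continuous (chart_inv i)};
  transition_smooth : forall i j,
    smooth_map_on [set x | obox (lo i) (hi i) x /\ dom j (chart_inv i x)]
      (chart_map j \o chart_inv i);
  (* transitions locally have the form (x, y) |-> (alpha (x, y), gamma y) *)
  transition_foliated : forall i j x,
    obox (lo i) (hi i) x -> dom j (chart_inv i x) ->
    \forall x' \near x, rsubmx x' = rsubmx x ->
      rsubmx (chart_map j (chart_inv i x')) = rsubmx (chart_map j (chart_inv i x))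
}.

Variable F : foliated_atlas.
Implicit Types (i j : chart F) (p : M) (x : 'rV[R]_(k + q)).

Definition img i : set 'rV[R]_(k + q) := obox (lo i) (hi i).

Inductive same_leaf : M -> M -> Prop :=
| same_plaque i p p' : dom i p -> dom i p' ->
    rsubmx (chart_map i p) = rsubmx (chart_map i p') -> same_leaf p p'
| same_leaf_trans p p' p'' :
    same_leaf p p' -> same_leaf p' p'' -> same_leaf p p''.

Definition leaf p : set M := [set p' | same_leaf p p'].

Definition smooth_fun (f : M -> R) : Prop :=
  forall i, smooth_on (img i) (f \o chart_inv i).

Definition basic (f : M -> R) : Prop :=
  forall p p', leaf p p' -> f p = f p'.

Definition metric := chart F -> 'rV[R]_(k + q) -> 'M[R]_(k + q).

Definition riemannian (g : metric) : Prop :=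
  [/\ forall i, smooth_map_on (img i) (g i),
      forall i x, img i x -> (g i x)^T = g i x,
      forall i x v, img i x -> v != 0 -> 0 < ip (g i x) v v
    & forall i j p, dom i p -> dom j p ->
        let J := 'J (chart_map j \o chart_inv i) (chart_map i p) in
        g i (chart_map i p) = J *m g j (chart_map j p) *m J^T].

(* V and H in a chart, as row spaces. *)
Definition vertical : 'M[R]_(k + q) := pid_mx k.

Definition horizontal (g : 'M[R]_(k + q)) : 'M[R]_(k + q) :=
  kermx (g *m vertical^T).

(* The restrictions g|_V and g|_H, extended by 0 to the complement. *)
Definition vpart (g : 'M[R]_(k + q)) : 'M[R]_(k + q) :=
  let P := proj_mx vertical (horizontal g) in P *m g *m P^T.

Definition hpart (g : 'M[R]_(k + q)) : 'M[R]_(k + q) :=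
  let P := proj_mx (horizontal g) vertical in P *m g *m P^T.

(* F is a Riemannian foliation for g (g is bundle-like): the horizontal part
   of g depends only on the transverse coordinates. *)
Definition bundle_like (g : metric) : Prop :=
  forall i x x', img i x -> img i x' -> rsubmx x = rsubmx x' ->
    hpart (g i x) = hpart (g i x').

Definition warped (f : M -> R) (g : metric) : metric :=
  fun i x => hpart (g i x) + expR (2 * f (chart_inv i x)) *: vpart (g i x).

Definition segment (g g' : metric) (t : R) : metric :=
  fun i x => (1 - t) *: g i x + t *: g' i x.

End Foliation.

Section Torus.
Variables (R : realType) (k q : nat) (M : topologicalType).
Variable F : foliated_atlas R k q M.
Implicit Types (tau : 'rV[R]_2 -> M) (a b : 'rV[R]_2 -> 'rV[R]_2).
Implicit Types (i : chart F) (g : metric F) (u : 'rV[R]_2).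

Definition read tau i : 'rV[R]_2 -> 'rV[R]_(k + q) := chart_map i \o tau.

(* Embedded torus: tau induces an injective immersion of R^2 / Z^2. *)
Definition embedded_torus tau : Prop :=
  [/\ continuous tau,
      forall u u', tau u = tau u' <->
        exists m : 'rV[int]_2, u' - u = map_mx intr m,
      forall i, smooth_map_on (tau @^-1` dom i) (read tau i)
    & forall i u, dom i (tau u) -> row_free ('J (read tau i) u)].

(* Vector fields on R^2 / Z^2; a represents the field d tau (a), tangent to the
   torus, whose components in the chart i are push tau a i. *)
Definition torus_field a : Prop :=
  smooth_map_on setT a /\
  forall u (m : 'rV[int]_2), a (u + map_mx intr m) = a u.

Definition push tau a i u : 'rV[R]_(k + q) := 'D_(a u) (read tau i) u.

(* Components at tau u of nabla_A B for A, B tangent to the torus. *)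
Definition torus_cov g tau a b i u : 'rV[R]_(k + q) :=
  cov (g i) (read tau i) a (push tau b i) u.

Definition totally_geodesic g tau : Prop :=
  forall a b, torus_field a -> torus_field b ->
  forall i u, dom i (tau u) ->
    (torus_cov g tau a b i u <= 'J (read tau i) u)%MS.

Definition induced_metric g tau i u : 'M[R]_2 :=
  let J := 'J (read tau i) u in J *m g i (read tau i u) *m J^T.

Definition flat g tau : Prop :=
  forall i u, dom i (tau u) ->
  forall v w z y, curv (induced_metric g tau i) u v w z y = 0.

(* R_g(X, Y, Y, X) at tau u; the value does not depend on the chart. *)
Definition torus_curv g tau a b u : R :=
  let i := chart_at F (tau u) in
  curv (g i) (read tau i u) (push tau a i u) (push tau b i u)
    (push tau b i u) (push tau a i u).

(* df(X) at tau u *)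
Definition torus_df (f : M -> R) tau a u : R :=
  let i := chart_at F (tau u) in
  'D_(push tau a i u) (f \o chart_inv i) (read tau i u).

(* || s Y ||_g^2 at tau u, for a scalar s *)
Definition torus_sqnorm g tau b (s : R) u : R :=
  let i := chart_at F (tau u) in
  ip (g i (read tau i u)) (s *: push tau b i u) (s *: push tau b i u).

Definition pt2 (z : R * R) : 'rV[R]_2 :=
  \row_(j < 2) (if j == 0 then z.1 else z.2).

(* Integral over the torus against the area form induced by g, computed on the
   fundamental domain [0, 1]^2. *)
Definition torus_integral g tau (h : 'rV[R]_2 -> R) : R :=
  \int[(@lebesgue_measure R \x @lebesgue_measure R)%E]_(z in
      `[0, 1] `*` `[0, 1])
    (h (pt2 z) *
     Num.sqrt (\det (induced_metric g tau (chart_at F (tau (pt2 z))) (pt2 z)))).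

End Torus.

(* Main.v *)
(* Idea. Write V = g0|_V, H = g0|_H, E = e^{2f} - 1, so that g_t = H + (1 + t E) V.
   In coordinates extending X and Y at a point of the torus to constant fields,
   R_t(X,Y,Y,X) is a sum of derivatives of first-kind Christoffel symbols, affine
   in t, and of g_t(nabla_X Y, nabla_X Y) - g_t(nabla_X X, nabla_Y Y). The relations
   nabla_X X = nabla_X Y = nabla_Y Y = 0 along the torus, together with the
   constancy of H along the leaves, say that the first-kind Christoffel symbols
   of V on X, Y are those of g0 composed with V. Hence, comparing with t = 0,
   nabla_X X is unchanged, nabla_X Y moves by t dE(X) / (2 (1 + t E)) Y and
   nabla_Y Y by -t/2 |Y|^2 grad E, and R_t(X,Y,Y,X) is an affine function of t plus
   t^2 dE(X)^2 |Y|^2 / (4 (1 + t E)). For r >= 2 its r-th derivative at 0 is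
   r! e^{4f} (1 - e^{2f})^{r-2} |df(X) Y|^2 pointwise. *)
Require Import Defs.
From HB Require Import structures.
From mathcomp Require Import all_boot all_order all_algebra.
From mathcomp Require Import all_classical all_reals all_analysis.
From mathcomp Require Import ring lra.
Import Order.TTheory GRing.Theory Num.Theory numFieldNormedType.Exports.
Local Open Scope classical_set_scope.
Local Open Scope ring_scope.
Set Implicit Arguments.
Unset Strict Implicit.
Unset Printing Implicit Defensive.

(** * Germs of twice differentiable functions and matrices *)

Section Germs.
Variables (R : realType) (V : normedModType R).
Implicit Types (x v : V).

(** The difference [g - f] vanishes near x, hence is a little-o of the increment with zero
    differential, and g is the sum of f and this difference. *)
Lemma near_eq_differentiable (W : normedModType R) (f g : V -> W) x :
  (\near x, f x = g x) -> differentiable f x -> differentiable g x.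
Proof.
move=> fg df; have -> : g = f + (g - f) by rewrite addrC subrK.
apply: differentiableD => //.
have h0 : \forall y \near x, (g - f) y = 0.
  apply: filterS fg => y fgy; rewrite !fctE.
  by rewrite fgy subrr.
have hlo : (g - f) \o shift x = cst ((g - f) x) + (\0 : V -> W) +o_ 0 id.
  apply/eqaddoP => _/posnumP[e].
  move: (h0); rewrite (near_shift 0) /= subr0 => h0'.
  apply: filterS h0' => y /= h0y.
  rewrite [X in `|X|](_ : _ = (g - f) (y + x) - ((g - f) x + 0)) //.
  by rewrite h0y (nbhs_singleton h0) addr0 subrr normr0 mulr_ge0.
have d0 : 'd (g - f) x = \0 :> (V -> W).
  by apply: diff_unique => //; exact: cst_continuous.
apply/diff_locallyP; rewrite d0; split => //; exact: cst_continuous.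
Qed.

(** Second derivatives exist at x but need not be continuous. This regularity of a metric is enough
    to differentiate its Christoffel symbols once at x, and it is stable under sums, products and
    inverses. *)
Definition C2_at (h : V -> R) x : Prop :=
  (\forall y \near x, differentiable h y) /\
  forall v, differentiable (fun y => 'D_v h y) x.

Lemma C2_at_diff (h : V -> R) x : C2_at h x -> differentiable h x.
Proof. by case=> /nbhs_singleton. Qed.

Lemma near_eq_C2_at (f g : V -> R) x :
  (\near x, f x = g x) -> C2_at f x -> C2_at g x.
Proof.
move=> fg [df d2f]; have fg' := near_join fg.
split=> [|v].
  by apply: filterS2 fg' df => y; exact: near_eq_differentiable.
apply: near_eq_differentiable (d2f v).
by apply: filterS fg' => y; exact: near_eq_derive.
Qed.

Lemma C2_at_cst (c : R) x : C2_at (fun=> c) x.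
Proof.
split=> [|v]; first by near=> y; exact: differentiable_cst.
have -> : (fun y => 'D_v (fun=> c) y) = cst (0 : R).
  by rewrite funeqE => y; exact: derive_cst.
exact: differentiable_cst.
Unshelve. all: by end_near. Qed.

Lemma C2_atD (f g : V -> R) x :
  C2_at f x -> C2_at g x -> C2_at (fun y => f y + g y) x.
Proof.
move=> [df d2f] [dg d2g]; split=> [|v].
  by apply: filterS2 df dg => y dfy dgy; exact: (differentiableD dfy dgy).
apply: (@near_eq_differentiable _ (fun y => 'D_v f y + 'D_v g y)).
  apply: filterS2 df dg => y dfy dgy.
  by apply/esym/deriveD; exact: diff_derivable.
exact: (differentiableD (d2f v) (d2g v)).
Qed.

Lemma C2_atM (f g : V -> R) x :
  C2_at f x -> C2_at g x -> C2_at (fun y => f y * g y) x.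
Proof.
move=> Cf Cg; have [df0 dg0] := (C2_at_diff Cf, C2_at_diff Cg).
move: Cf Cg => [df d2f] [dg d2g]; split=> [|v].
  by apply: filterS2 df dg => y dfy dgy; exact: (differentiableM dfy dgy).
apply: (@near_eq_differentiable _ (fun y => f y * 'D_v g y + g y * 'D_v f y)).
  apply: filterS2 df dg => y dfy dgy.
  by apply/esym/deriveM; exact: diff_derivable.
exact: (differentiableD (differentiableM df0 (d2g v)) (differentiableM dg0 (d2f v))).
Qed.

Lemma C2_atV (f : V -> R) x : f x != 0 -> C2_at f x -> C2_at (fun y => (f y)^-1) x.
Proof.
move=> fx0 Cf; have df0 := C2_at_diff Cf; case: Cf => df d2f.
have fn0 : \forall y \near x, f y != 0.
  have := differentiable_continuous df0.
  by move/cvgr_neq0; apply.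
split=> [|v].
  by apply: filterS2 df fn0 => y dfy fy0; exact: (differentiableV dfy fy0).
apply: (@near_eq_differentiable _ (fun y => - ((f y)^-1 * (f y)^-1) * 'D_v f y)).
  apply: filterS2 df fn0 => y dfy fy0.
  by rewrite (deriveV fy0) -?exprVn ?expr2//; exact: diff_derivable.
have dV := differentiableV df0 fx0.
apply: (differentiableM _ (d2f v)).
by apply: differentiableN; exact: (differentiableM dV dV).
Qed.

Lemma C2_at_sum I (s : seq I) (P : pred I) (f : I -> V -> R) x :
  (forall i, P i -> C2_at (f i) x) -> C2_at (fun y => \sum_(i <- s | P i) f i y) x.
Proof.
move=> Cf; elim: s => [|i s IHs].
  by under eq_fun do rewrite big_nil; exact: C2_at_cst.
under eq_fun do rewrite big_cons; case Pi: (P i) => //.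
by apply: C2_atD => //; exact: Cf.
Qed.

Lemma C2_at_prod I (s : seq I) (P : pred I) (f : I -> V -> R) x :
  (forall i, P i -> C2_at (f i) x) -> C2_at (fun y => \prod_(i <- s | P i) f i y) x.
Proof.
move=> Cf; elim: s => [|i s IHs].
  by under eq_fun do rewrite big_nil; exact: C2_at_cst.
under eq_fun do rewrite big_cons; case Pi: (P i) => //.
by apply: C2_atM => //; exact: Cf.
Qed.

Definition C2_mx m n (A : V -> 'M[R]_(m, n)) x : Prop :=
  forall i j, C2_at (fun y => A y i j) x.

Lemma C2_mx_cst m n (A : 'M[R]_(m, n)) x : C2_mx (fun=> A) x.
Proof. by move=> i j; exact: C2_at_cst. Qed.

Lemma C2_mxM m n p (A : V -> 'M[R]_(m, n)) (B : V -> 'M[R]_(n, p)) x :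
  C2_mx A x -> C2_mx B x -> C2_mx (fun y => A y *m B y) x.
Proof.
move=> CA CB i j; under eq_fun do rewrite mxE.
by apply: C2_at_sum => l _; exact: C2_atM.
Qed.

Lemma C2_at_det n (A : V -> 'M[R]_n) x : C2_mx A x -> C2_at (fun y => \det (A y)) x.
Proof.
move=> CA; apply: C2_at_sum => s _; apply: C2_atM; first exact: C2_at_cst.
by apply: C2_at_prod.
Qed.

Lemma C2_mx_adj n (A : V -> 'M[R]_n) x : C2_mx A x -> C2_mx (fun y => \adj (A y)) x.
Proof.
move=> CA i j; under eq_fun do rewrite mxE.
apply: C2_atM; first exact: C2_at_cst.
by apply: C2_at_det => i' j'; under eq_fun do rewrite !mxE.
Qed.

Lemma near_unitmx n (A : V -> 'M[R]_n) x : C2_mx A x -> A x \in unitmx ->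
  \forall y \near x, A y \in unitmx.
Proof.
move=> CA; rewrite unitmxE unitfE => Ax.
have /C2_at_diff/differentiable_continuous/cvgr_neq0/(_ Ax) := C2_at_det CA.
by apply: filterS => y; rewrite unitmxE unitfE.
Qed.

(** Near x, [invmx] is the adjugate divided by the determinant; its default value at singular
    matrices does not enter, because invertibility is an open condition. *)
Lemma C2_mx_inv n (A : V -> 'M[R]_n) x : C2_mx A x -> A x \in unitmx ->
  C2_mx (fun y => invmx (A y)) x.
Proof.
move=> CA Ax i j; have An := near_unitmx CA Ax.
apply: (@near_eq_C2_at (fun y => (\det (A y))^-1 * \adj (A y) i j)).
  by apply: filterS An => y Ay; rewrite /invmx Ay [RHS]mxE.
apply: C2_atM; last exact: C2_mx_adj.
by apply: C2_atV; [rewrite -unitfE -unitmxE | exact: C2_at_det].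
Qed.

Lemma differentiable_mx m n (A : V -> 'M[R]_(m, n)) x :
  (forall i j, differentiable (fun y => A y i j) x) -> differentiable A x.
Proof.
move=> dA.
have -> : A = \sum_(i < m) \sum_(j < n) (fun y => A y i j *: delta_mx i j).
  rewrite funeqE => y; rewrite [LHS]matrix_sum_delta fct_sumE.
  by apply: eq_bigr => i _; rewrite fct_sumE.
apply: differentiable_sum => i; apply: differentiable_sum => j.
exact: (differentiableZl (delta_mx i j) (dA i j)).
Qed.

End Germs.

(** * Product rules for matrix-valued functions *)

Section MatrixDerivatives.
Variables (R : realType) (V : normedModType R).
Implicit Types (x d : V).

Lemma is_derive_sum_seq I (s : seq I) (P : pred I) (h : I -> V -> R) (dh : I -> R) x d :
  (forall i, P i -> is_derive x d (h i) (dh i)) ->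
  is_derive x d (fun y => \sum_(i <- s | P i) h i y) (\sum_(i <- s | P i) dh i).
Proof.
move=> hd; elim: s => [|i s IHs].
  under eq_fun do rewrite big_nil; rewrite big_nil; exact: is_derive_cst.
under eq_fun do rewrite big_cons; rewrite big_cons; case Pi: (P i) => //.
exact: (is_deriveD (hd i Pi) IHs).
Qed.

Lemma is_derive_mxP m n (A : V -> 'M[R]_(m, n)) (dA : 'M[R]_(m, n)) x d :
  is_derive x d A dA <-> forall i j, is_derive x d (fun y => A y i j) (dA i j).
Proof.
split=> [[/[dup] dvA /derivable_mxP dvij <-] i j|dAij].
  by apply: DeriveDef; rewrite // derive_mx // mxE.
have dvA : derivable A x d by apply/derivable_mxP => i j; case: (dAij i j).
apply: DeriveDef => //; rewrite derive_mx //; apply/matrixP => i j.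
by rewrite mxE; case: (dAij i j).
Qed.

Lemma is_derive_mulmx m n p (A : V -> 'M[R]_(m, n)) (B : V -> 'M[R]_(n, p)) dA dB x d :
  is_derive x d A dA -> is_derive x d B dB ->
  is_derive x d (fun y => A y *m B y) (dA *m B x + A x *m dB).
Proof.
move=> /is_derive_mxP hA /is_derive_mxP hB; apply/is_derive_mxP => i j.
under eq_fun do rewrite mxE; rewrite !mxE -big_split.
apply: is_derive_sum_seq => l _ /=.
apply: (is_derive_eq (is_deriveM (hA i l) (hB l j))).
by rewrite addrC /GRing.scale /= [B x l j * _]mulrC.
Qed.

Lemma is_derive_trmx m n (A : V -> 'M[R]_(m, n)) dA x d :
  is_derive x d A dA -> is_derive x d (fun y => (A y)^T) dA^T.
Proof.
move=> /is_derive_mxP hA; apply/is_derive_mxP => i j.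
by under eq_fun do rewrite mxE; rewrite mxE.
Qed.

Lemma is_derive_ip n (A : V -> 'M[R]_n) (p r : V -> 'rV[R]_n) dA dp dr x d :
  is_derive x d A dA -> is_derive x d p dp -> is_derive x d r dr ->
  is_derive x d (fun y => ip (A y) (p y) (r y))
    (ip dA (p x) (r x) + ip (A x) dp (r x) + ip (A x) (p x) dr).
Proof.
move=> hA hp hr; have := is_derive_mulmx (is_derive_mulmx hp hA) (is_derive_trmx hr).
move=> /is_derive_mxP/(_ 0 0)/is_derive_eq; apply.
by rewrite /ip mulmxDl [LHS]mxE [X in X + _ = _]mxE [X in X + _ = _]addrC.
Qed.

Lemma C2_mx_derivable m n (A : V -> 'M[R]_(m, n)) x d : C2_mx A x -> derivable A x d.
Proof. by move=> CA; apply/derivable_mxP => i j; exact/diff_derivable/C2_at_diff. Qed.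

End MatrixDerivatives.

(** * Bilinear algebra of a metric at one point *)

Section Ip.
Variables (R : realType) (n : nat).
Implicit Types (g h : 'M[R]_n) (v w z : 'rV[R]_n) (c : R).

Lemma ipDl g v w z : ip g (v + w) z = ip g v z + ip g w z.
Proof. by rewrite /ip !mulmxDl mxE. Qed.

Lemma ipDr g v w z : ip g v (w + z) = ip g v w + ip g v z.
Proof. by rewrite /ip linearD mulmxDr mxE. Qed.

Lemma ipZl g c v w : ip g (c *: v) w = c * ip g v w.
Proof. by rewrite /ip -!scalemxAl mxE. Qed.

Lemma ipZr g c v w : ip g v (c *: w) = c * ip g v w.
Proof. by rewrite /ip linearZ -scalemxAr mxE. Qed.

Lemma ip0l g w : ip g 0 w = 0.
Proof. by rewrite /ip !mul0mx mxE. Qed.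

Lemma ip0r g v : ip g v 0 = 0.
Proof. by rewrite /ip trmx0 mulmx0 mxE. Qed.

Lemma ipNl g v w : ip g (- v) w = - ip g v w.
Proof. by rewrite -scaleN1r ipZl mulN1r. Qed.

Lemma ipBl g v w z : ip g (v - w) z = ip g v z - ip g w z.
Proof. by rewrite ipDl ipNl. Qed.

Lemma ip_addmx g h v w : ip (g + h) v w = ip g v w + ip h v w.
Proof. by rewrite /ip mulmxDr mulmxDl mxE. Qed.

Lemma ip_scalemx c g v w : ip (c *: g) v w = c * ip g v w.
Proof. by rewrite /ip -scalemxAr -scalemxAl mxE. Qed.

Lemma ip_sym g v w : g^T = g -> ip g v w = ip g w v.
Proof.
move=> gT; rewrite /ip -[v *m g *m w^T]trmxK mxE.
by rewrite !trmx_mul trmxK gT mulmxA.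
Qed.

Lemma ip_row_sum g v w : ip g v w = \sum_j w 0 j * ip g v (delta_mx 0 j).
Proof.
rewrite [in LHS](row_sum_delta w) /ip linear_sum mulmx_sumr summxE.
by apply: eq_bigr => j _; rewrite linearZ -scalemxAr mxE.
Qed.

Lemma ip_inj g v w : g \in unitmx -> (forall l, ip g v l = ip g w l) -> v = w.
Proof.
move=> gU vw; apply: (can_inj (mulmxK gU)); apply/rowP => j.
by have := vw (delta_mx 0 j); rewrite /ip trmx_delta -!colE ![col _ _ _ _]mxE.
Qed.

End Ip.

(** * Curvature through Christoffel symbols of the first kind *)

Section Curvature.
Variables (R : realType) (n : nat).
Implicit Types (G A B : 'rV[R]_n -> 'M[R]_n) (x v w l : 'rV[R]_n).

Lemma derive_row_sum (h : 'rV[R]_n -> R) x v : differentiable h x ->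
  'D_v h x = \sum_j v 0 j * 'D_(delta_mx 0 j) h x.
Proof.
move=> dh; rewrite deriveE // [in LHS](row_sum_delta v) linear_sum.
by apply: eq_bigr => j _; rewrite linearZ deriveE.
Qed.

(** Near x a directional derivative is a combination of partial derivatives with constant
    coefficients, and these are differentiable by smoothness. *)
Lemma smooth_on_C2_at (O : set 'rV[R]_n) (h : 'rV[R]_n -> R) x :
  open O -> smooth_on O h -> O x -> C2_at h x.
Proof.
move=> Oop hO Ox; have On : nbhs x O by exact: open_nbhs_nbhs.
split=> [|v]; first by apply: filterS On => y Oy; exact: (hO [::]).
apply: (@near_eq_differentiable _ _ _ (\sum_j (fun y => v 0 j * partial j h y))).
  apply: filterS On => y Oy; rewrite fct_sumE (derive_row_sum v (hO [::] y Oy)).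
  by [].
apply: differentiable_sum => j; apply: differentiableZ; exact: (hO [:: j]).
Qed.

Lemma smooth_on_C2_mx m1 m2 (O : set 'rV[R]_n) (h : 'rV[R]_n -> 'M[R]_(m1, m2)) x :
  open O -> smooth_map_on O h -> O x -> C2_mx h x.
Proof. by move=> Oop hO Ox i j; exact: (smooth_on_C2_at Oop (hO i j)). Qed.

Lemma C2_at_ip G x v w : C2_mx G x -> C2_at (fun y => ip (G y) v w) x.
Proof.
by move=> CG; apply: (C2_mxM (C2_mxM (C2_mx_cst v x) CG) (C2_mx_cst w^T x)).
Qed.

(** One neighbourhood serves all v and w: the pairing is a linear combination of the entries of G,
    of which there are finitely many. *)
Lemma near_differentiable_ip G x : C2_mx G x ->
  \forall y \near x, forall v w, differentiable (fun z => ip (G z) v w) y.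
Proof.
move=> CG; have Gn : \forall y \near x, forall ij : 'I_n * 'I_n,
    differentiable (fun z => G z ij.1 ij.2) y.
  exact: (filter_forall (nbhs_filter x) (fun ij => (CG ij.1 ij.2).1)).
apply: filterS Gn => y dG v w.
have -> : (fun z => ip (G z) v w)
    = \sum_j \sum_i (fun z => w 0 j *: (v 0 i *: G z i j)).
  rewrite funeqE => z; rewrite fct_sumE /ip mxE; apply: eq_bigr => j _.
  rewrite fct_sumE !mxE mulr_suml; apply: eq_bigr => i _.
  by rewrite mulrC.
apply: differentiable_sum => j; apply: differentiable_sum => i.
by do 2!apply: differentiableZ; exact: (dG (i, j)).
Qed.

(* The Christoffel symbol of the first kind, G(nabla_v w, l). *)
Definition koszul G v w l x : R :=
  2^-1 * ('D_v (fun y => ip (G y) w l) x + 'D_w (fun y => ip (G y) v l) x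
          - 'D_l (fun y => ip (G y) v w) x).

(** [christoffel] prescribes the pairings with coordinate vectors only; both sides are linear in l,
    the term with ['D_l] by differentiability. *)
Lemma ip_christoffel G x v w l :
  (forall p q, differentiable (fun y => ip (G y) p q) x) -> G x \in unitmx ->
  ip (G x) (christoffel G x v w) l = koszul G v w l x.
Proof.
move=> dG Gx.
have dsum d p : 'D_d (fun y => ip (G y) p l) x
    = \sum_j l 0 j * 'D_d (fun y => ip (G y) p (delta_mx 0 j)) x.
  have -> : (fun y => ip (G y) p l)
      = \sum_j (fun y => l 0 j * ip (G y) p (delta_mx 0 j)).
    by rewrite funeqE => y; rewrite fct_sumE ip_row_sum.
  rewrite derive_sum => [|j]; last exact/derivableZ/diff_derivable.
  by apply: eq_bigr => j _; rewrite deriveZ //; exact: diff_derivable.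
rewrite /ip /christoffel mulmxKV // -scalemxAl mxE /koszul; congr (_ * _).
rewrite !dsum (derive_row_sum l (dG v w)) -big_split -sumrB mxE.
by apply: eq_bigr => j _; rewrite !mxE mulrC mulrBr mulrDr.
Qed.

Lemma derivable_christoffel G x v w d : C2_mx G x -> G x \in unitmx ->
  derivable (fun y => christoffel G y v w) x d.
Proof.
move=> CG Gx; have dD p q r : derivable (fun y => 'D_p (fun y => ip (G y) q r) y) x d.
  by apply: diff_derivable; apply: (C2_at_ip q r CG).2.
have dinv : derivable (fun y => invmx (G y)) x d by exact/C2_mx_derivable/C2_mx_inv.
pose r y := 2^-1 *: (\row_l ('D_v (fun y => ip (G y) w (delta_mx 0 l)) y
                 + 'D_w (fun y => ip (G y) v (delta_mx 0 l)) y
                 - 'D_(delta_mx 0 l) (fun y => ip (G y) v w) y)).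
have dr : derivable r x d.
  apply: derivableZ; apply/derivable_mxP => i j; under eq_fun do rewrite mxE.
  by apply: derivableB => //; apply: derivableD.
by have [] := is_derive_mulmx (derivableP dr) (derivableP dinv).
Qed.

Lemma nabla_cst G v w : nabla G (cst v) (cst w) = fun x => christoffel G x v w.
Proof.
by rewrite funeqE => x; rewrite /nabla /cov derive_cst add0r derive_id.
Qed.

Lemma derive_ip_cst G x d v w : C2_mx G x ->
  'D_d (fun y => ip (G y) v w) x = ip ('D_d G x) v w.
Proof.
move=> CG; have dG : is_derive x d G _ := derivableP (C2_mx_derivable CG).
have [_ ->] := is_derive_ip dG (is_derive_cst v x d) (is_derive_cst w x d).
by rewrite /ip trmx0 mulmx0 !mul0mx !mxE !addr0.
Qed.

(** Near x, [koszul G w z l] is the pairing of nabla_w z with l. The product rule along v isolates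
    the derivative of nabla_w z; the derivative of G, paired with nabla_w z frozen at x, is
    subtracted. *)
Lemma ip_nabla_nabla G x v w z l : C2_mx G x -> G x \in unitmx ->
  ip (G x) (nabla G (cst v) (nabla G (cst w) (cst z)) x) l =
  'D_v (koszul G w z l) x
  - 'D_v (fun y => ip (G y) (christoffel G x w z) l) x
  + koszul G v (christoffel G x w z) l x.
Proof.
move=> CG Gx; have dGn := near_differentiable_ip CG.
rewrite nabla_cst /nabla /cov derive_id ipDl ip_christoffel //; last first.
  exact: nbhs_singleton dGn.
rewrite derive_ip_cst //; congr (_ + _); apply/eqP; rewrite eq_sym subr_eq addrC; apply/eqP.
have dG : is_derive x v G _ := derivableP (C2_mx_derivable CG).
have dC : is_derive x v (fun y => christoffel G y w z) _ :=
  derivableP (derivable_christoffel CG Gx).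
have := is_derive_ip dG dC (is_derive_cst l x v).
rewrite [X in _ + X](_ : _ = 0) ?addr0; last by rewrite /ip trmx0 mulmx0 mxE.
case=> _ <-; apply: near_eq_derive.
apply: filterS2 dGn (near_unitmx CG Gx) => y dGy Gy.
by rewrite ip_christoffel.
Qed.

(** With c = nabla_w w frozen at x, symmetry of G reduces -D_v G(c, v) + [koszul G v c v] to
    -[koszul G v v c], which is -G(nabla_v v, c). In the same way the terms in b = nabla_v w add up
    to G(nabla_v w, b). *)
Lemma curv_koszul G x v w : C2_mx G x -> G x \in unitmx ->
  (\forall y \near x, (G y)^T = G y) ->
  curv G x v w w v = 'D_v (koszul G w w v) x - 'D_w (koszul G v w v) x
    + ip (G x) (christoffel G x v w) (christoffel G x v w)
    - ip (G x) (christoffel G x v v) (christoffel G x w w).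
Proof.
move=> CG Gx GT; have dG := nbhs_singleton (near_differentiable_ip CG).
apply: (etrans (ipBl _ _ _ _)).
apply: (etrans (congr2 (fun p q => p - q) (ip_nabla_nabla v w w v CG Gx)
                                         (ip_nabla_nabla w v w v CG Gx))).
rewrite (ip_christoffel v w _ dG Gx) (ip_christoffel v v _ dG Gx).
move: (christoffel G x w w) (christoffel G x v w) => c b.
move: ('D_v (koszul G w w v) x) ('D_w (koszul G v w v) x) => k1 k2.
(* Abstracting the derivative keeps unification from unfolding limits. *)
have [D DE Dsym] : exists2 D : 'rV[R]_n -> 'rV[R]_n -> 'rV[R]_n -> R,
    forall d p q, 'D_d (fun y => ip (G y) p q) x = D d p q
  & forall d p q, D d p q = D d q p.
  exists (fun d p q => 'D_d (fun y => ip (G y) p q) x) => // d p q.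
  by apply: near_eq_derive; apply: filterS GT => y; exact: ip_sym.
rewrite /koszul !DE (Dsym v v c) (Dsym w v b) (Dsym b v w).
by field.
Qed.

End Curvature.

(** * Curvature of the metrics g + t E V *)

Section Warping.
Variables (R : realType) (n : nat).
Implicit Types (G A B : 'rV[R]_n -> 'M[R]_n) (x v w l : 'rV[R]_n).

Lemma C2_mxD m1 m2 (A B : 'rV[R]_n -> 'M[R]_(m1, m2)) x :
  C2_mx A x -> C2_mx B x -> C2_mx (fun y => A y + B y) x.
Proof. by move=> CA CB i j; under eq_fun do rewrite mxE; exact: C2_atD. Qed.

Lemma C2_mxZ m1 m2 (h : 'rV[R]_n -> R) (A : 'rV[R]_n -> 'M[R]_(m1, m2)) x :
  C2_at h x -> C2_mx A x -> C2_mx (fun y => h y *: A y) x.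
Proof. by move=> Ch CA i j; under eq_fun do rewrite mxE; exact: C2_atM. Qed.

Lemma near_eq_C2_mx m1 m2 (A B : 'rV[R]_n -> 'M[R]_(m1, m2)) x :
  (\near x, A x = B x) -> C2_mx A x -> C2_mx B x.
Proof. by move=> AB CA i j; apply: near_eq_C2_at (CA i j); apply: filterS AB => y ->. Qed.

Lemma near_eq_koszul A B v w l x : (\near x, A x = B x) ->
  koszul A v w l x = koszul B v w l x.
Proof.
move=> AB; have dAB d p q :
    'D_d (fun y => ip (A y) p q) x = 'D_d (fun y => ip (B y) p q) x.
  by apply: near_eq_derive; apply: filterS AB => y ->.
by rewrite /koszul !dAB.
Qed.

Lemma koszul_affine A B (t : R) v w l x :
  (forall p q, differentiable (fun y => ip (A y) p q) x) ->
  (forall p q, differentiable (fun y => ip (B y) p q) x) ->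
  koszul (fun y => A y + t *: B y) v w l x = koszul A v w l x + t * koszul B v w l x.
Proof.
move=> dA dB; have dAB d p q : 'D_d (fun y => ip (A y + t *: B y) p q) x
    = 'D_d (fun y => ip (A y) p q) x + t * 'D_d (fun y => ip (B y) p q) x.
  under eq_fun do rewrite ip_addmx ip_scalemx.
  have dAp : derivable (fun y => ip (A y) p q) x d := diff_derivable (dA p q).
  have dBp : derivable (fun y => ip (B y) p q) x d := diff_derivable (dB p q).
  by rewrite (deriveD dAp (derivableZ (k:=t) dBp)) (deriveZ t dBp).
rewrite /koszul !dAB mulrCA -mulrDr; congr (_ * _).
by rewrite mulrBr mulrDr !opprD !addrA; lra.
Qed.

Lemma koszul_scale (h : 'rV[R]_n -> R) A v w l x :
  differentiable h x -> (forall p q, differentiable (fun y => ip (A y) p q) x) ->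
  koszul (fun y => h y *: A y) v w l x = h x * koszul A v w l x
    + 2^-1 * ('D_v h x * ip (A x) w l + 'D_w h x * ip (A x) v l
              - 'D_l h x * ip (A x) v w).
Proof.
move=> dh dA; have dhA d p q : 'D_d (fun y => ip (h y *: A y) p q) x
    = h x * 'D_d (fun y => ip (A y) p q) x + ip (A x) p q * 'D_d h x.
  under eq_fun do rewrite ip_scalemx.
  have dAp : derivable (fun y => ip (A y) p q) x d := diff_derivable (dA p q).
  by rewrite (deriveM (diff_derivable dh) dAp).
rewrite /koszul !dhA.
move: ('D_v (fun y => ip (A y) w l) x) ('D_w (fun y => ip (A y) v l) x).
move: ('D_l (fun y => ip (A y) v w) x) ('D_v h x) ('D_w h x) ('D_l h x).
by move=> *; field.
Qed.

Lemma differentiable_koszul G v w l x : C2_mx G x -> differentiable (koszul G v w l) x.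
Proof.
move=> CG; have dD p q r : differentiable (fun y => 'D_p (fun y => ip (G y) q r) y) x.
  exact: (C2_at_ip q r CG).2.
exact: (differentiableZ 2^-1 (differentiableB (differentiableD (dD v w l) (dD w v l)) (dD l v w))).
Qed.

Lemma derive_koszul_affine A B (t : R) v w l x d : C2_mx A x -> C2_mx B x ->
  'D_d (koszul (fun y => A y + t *: B y) v w l) x
  = 'D_d (koszul A v w l) x + t * 'D_d (koszul B v w l) x.
Proof.
move=> CA CB.
have kA : derivable (koszul A v w l) x d := diff_derivable (differentiable_koszul v w l CA).
have kB : derivable (koszul B v w l) x d := diff_derivable (differentiable_koszul v w l CB).
transitivity ('D_d (koszul A v w l + t *: koszul B v w l) x); last first.
  by rewrite (deriveD kA (derivableZ (k:=t) kB)) (deriveZ t kB).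
apply: near_eq_derive.
apply: filterS2 (near_differentiable_ip CA) (near_differentiable_ip CB) => y dA dB.
by rewrite koszul_affine.
Qed.

(** Here v is horizontal, w vertical and N the gradient of E. Pairing with w is scaled by 1 + t E,
    so in the square of nabla_v w the cross term loses its denominator and is linear in t, while the
    square of the correction keeps one factor 1 / (1 + t E). As V(N, .) = 0, the pairing of nabla_v
    v with nabla_w w is affine in t. *)
Lemma curv_warped (g V : 'rV[R]_n -> 'M[R]_n) (E : 'rV[R]_n -> R)
    (G : R -> 'rV[R]_n -> 'M[R]_n) x v w (N : 'rV[R]_n) :
  C2_mx g x -> C2_mx V x -> C2_at E x -> g x \in unitmx ->
  (\forall y \near x, (g y)^T = g y) -> (\forall y \near x, (V y)^T = V y) ->
  (forall t, \forall y \near x, G t y = g y + t *: (E y *: V y)) ->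
  v *m V x = 0 -> w *m V x = w *m g x ->
  (forall l, koszul V v v l x = ip (V x) (christoffel g x v v) l) ->
  (forall l, koszul V v w l x = ip (V x) (christoffel g x v w) l) ->
  (forall l, koszul V w w l x = ip (V x) (christoffel g x w w) l) ->
  'D_w E x = 0 -> (forall l, 'D_l E x = ip (g x) N l) -> N *m V x = 0 ->
  exists k m, forall t, G t x \in unitmx -> 1 + t * E x != 0 ->
    curv (G t) x v w w v = k + m * t
      + t ^+ 2 * ('D_v E x ^+ 2 * ip (g x) w w / 4) / (1 + t * E x).
Proof.
move=> CG CV CE gU gT VT GE vV wV Pvv Pvw Pww wE NE NV.
pose B y := E y *: V y; have CB : C2_mx B x by exact: C2_mxZ.
pose a := christoffel g x v v; pose b := christoffel g x v w.
pose c := christoffel g x w w.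
have Vv l : ip (V x) v l = 0 by rewrite /ip vV mul0mx mxE.
have VN l : ip (V x) N l = 0 by rewrite /ip NV mul0mx mxE.
have Vw l : ip (V x) w l = ip (g x) w l by rewrite /ip wV.
have gs := nbhs_singleton gT; have Vs := nbhs_singleton VT.
have dg := nbhs_singleton (near_differentiable_ip CG).
have dV := nbhs_singleton (near_differentiable_ip CV).
have dB := nbhs_singleton (near_differentiable_ip CB).
have dE := C2_at_diff CE.
pose k1 := 'D_v (koszul g w w v) x - 'D_w (koszul g v w v) x.
pose m1 := 'D_v (koszul B w w v) x - 'D_w (koszul B v w v) x.
pose dv := 'D_v E x; pose s := E x; pose q := ip (g x) w w.
(* The coefficients of 1 and t in the final expansion: [dv * ip (g x) w b] is the cross term of the
   square of nabla_v w, and [q / 2 * ip (g x) a N] comes from the gradient correction of nabla_w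
   w. *)
exists (k1 + ip (g x) b b - ip (g x) a c), (m1 + s * ip (V x) b b
  + dv * ip (g x) w b - s * ip (V x) a c + q / 2 * ip (g x) a N) => t Gt phi0.
have Gn := GE t; have Gx := nbhs_singleton Gn.
have CGt : C2_mx (G t) x.
  apply: (@near_eq_C2_mx _ _ (fun y => g y + t *: B y)).
    by apply: filterS Gn => y ->.
  by apply: C2_mxD => //; apply: (@C2_mxZ _ _ (fun=> t)) => //; exact: C2_at_cst.
have GT : \forall y \near x, (G t y)^T = G t y.
  apply: filterS3 Gn gT VT => y -> gy Vy.
  by apply/matrixP => i j; rewrite -{2}gy -{2}Vy !mxE.
have ipG p r : ip (G t x) p r = ip (g x) p r + t * (s * ip (V x) p r).
  by rewrite Gx ip_addmx !ip_scalemx.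
have Gchr p r l : ip (G t x) (christoffel (G t) x p r) l
    = koszul g p r l x + t * (s * koszul V p r l x
      + 2^-1 * ('D_p E x * ip (V x) r l + 'D_r E x * ip (V x) p l
                - 'D_l E x * ip (V x) p r)).
  rewrite (ip_christoffel _ _ _ (nbhs_singleton (near_differentiable_ip CGt)) Gt).
  rewrite (near_eq_koszul _ _ _ Gn) (koszul_affine _ _ _ _ dg dB).
  by rewrite (koszul_scale _ _ _ dE dV).
(* A vector is determined by its pairings under the invertible [G t x], so each proposed value is
   checked against every l. *)
have ea : christoffel (G t) x v v = a.
  apply: (ip_inj Gt) => l; rewrite Gchr Pvv !Vv ipG -(ip_christoffel _ _ _ dg gU).
  by rewrite -/a -/s; ring.
(* Since [G t x] pairs w as (1 + t s) times g does, solving for the multiple of w divides by 1 + t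
   s. *)
have eb : christoffel (G t) x v w = b + (t * dv / (2 * (1 + t * s))) *: w.
  apply: (ip_inj Gt) => l; rewrite Gchr Pvw ipG ipDl ipDl !ipZl.
  rewrite -(ip_christoffel _ _ _ dg gU) -/b -/s -/dv Vv wE Vv Vw.
  by field.
(* On N the metrics [G t x] and [g x] agree, because V annihilates N; hence there is no
   denominator. *)
have ec : christoffel (G t) x w w = c + (- (t * q / 2)) *: N.
  apply: (ip_inj Gt) => l; rewrite Gchr Pww ipG ipDl ipDl !ipZl.
  rewrite -(ip_christoffel _ _ _ dg gU) -/c -/s wE !Vw VN NE -/q.
  by field.
have dk z p r : 'D_z (koszul (G t) p r v) x
    = 'D_z (koszul g p r v) x + t * 'D_z (koszul B p r v) x.
  apply: etrans (derive_koszul_affine _ _ _ _ _ CG CB); apply: near_eq_derive.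
  by apply: filterS (near_join Gn) => y Gy; exact: near_eq_koszul.
have kE : 'D_v (koszul (G t) w w v) x - 'D_w (koszul (G t) v w v) x = k1 + t * m1.
  have aux (p r p' r' : R) : p + t * p' - (r + t * r') = p - r + t * (p' - r') by ring.
  by apply: (etrans (congr2 (fun p r => p - r) (dk v w w) (dk w v w))); exact: aux.
rewrite (curv_koszul _ _ CGt Gt GT) ea eb ec kE -/dv -/s -/q; rewrite -/s in phi0.
move: a b c k1 m1 dv s phi0 {kE Pvv Pvw Pww Gchr ea eb ec} ipG => a b c k1 m1 dv s phi0 ipG.
have cE : ip (V x) a N = 0 by rewrite ip_sym.
rewrite !(ipDr, ipDl, ipZl, ipZr, ipG) !Vw cE.
rewrite (ip_sym b w gs) (ip_sym b w Vs) !Vw -/q.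
by field.
Qed.

End Warping.

(** * Higher derivatives in t of the curvature formula *)

Section DerivativesInTime.
Variables (R : realType) (k m C s : R).

Lemma near_eq_derive1n (f g : R -> R) n x : (\near x, f x = g x) ->
  derive1n n f x = derive1n n g x.
Proof.
(* Equality at x alone cannot be differentiated, so the induction carries equality on a
   neighbourhood. *)
move=> fg; suff : \forall y \near x, derive1n n f y = derive1n n g y by exact: nbhs_singleton.
elim: n => [//|n /near_join]; apply: filterS => y fgy.
by rewrite !derive1nS !derive1E; exact: near_eq_derive.
Qed.

Let psi (t : R) := (1 + t * s)^-1.

Let near_neq0 t : 1 + t * s != 0 -> \forall t' \near t, 1 + t' * s != 0.
Proof.
have : (fun t => 1 + t * s) @ t --> 1 + t * s.
  by apply: cvgD; [exact: cvg_cst | apply: cvgM; [exact: cvg_id | exact: cvg_cst]].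
by move/cvgr_neq0; apply.
Qed.

Let is_derive_psi t : 1 + t * s != 0 -> is_derive t 1 psi (- s * psi t ^+ 2).
Proof.
move=> t0; pose h (t : R) := 1 + t * s.
have [dd De] : is_derive t (1 : R) h s.
  have := is_deriveD (is_derive_cst (1 : R) t 1)
    (is_deriveM (is_derive_id t 1) (is_derive_cst s t 1)).
  by move/is_derive_eq; apply; rewrite scaler0 !add0r /GRing.scale /= mulr1.
apply: DeriveDef; first exact: (@derivableV _ _ h t 1 t0 dd).
rewrite (@deriveV _ _ h t 1 t0 dd) De /psi /h -exprVn /GRing.scale /=; ring.
Qed.

Let is_derive_psiX n t : 1 + t * s != 0 ->
  is_derive t 1 (fun t => psi t ^+ n) (- s * n%:R * psi t ^+ n.+1).
Proof.
move=> t0; have -> : (fun t => psi t ^+ n) = psi ^+ n by rewrite funeqE => y; rewrite exprfctE.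
have := is_deriveX n (is_derive_psi t0).
move/is_derive_eq; apply; rewrite /GRing.scale /=.
by case: n => [|n]; rewrite ?mul0r ?mulr0 ?mul0r //= !exprS; ring.
Qed.

(** The set 1 + t s != 0 is open, so a closed form valid on all of it can be differentiated to give
    the next order. *)
Let derive1n_step (K F : R -> R) dF n :
  (forall t, 1 + t * s != 0 -> derive1n n K t = F t) ->
  (forall t, 1 + t * s != 0 -> is_derive t 1 F (dF t)) ->
  forall t, 1 + t * s != 0 -> derive1n n.+1 K t = dF t.
Proof.
move=> KF FdF t t0; rewrite derive1nS derive1E.
rewrite (@near_eq_derive _ _ _ _ F); first by case: (FdF t t0).
by apply: filterS (near_neq0 t0) => t'; exact: KF.
Qed.

(** The affine part disappears at order two, where the quotient becomes 2 C / (1 + t s)^3; from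
    there on only powers of [psi] are differentiated. The order is rewritten as [r.+2] so that the
    induction starts there. *)
Lemma derive1n_warped_curvature r : (2 <= r)%N ->
  derive1n r (fun t => k + m * t + t ^+ 2 * C / (1 + t * s)) 0
  = r`!%:R * (C * (- s) ^+ (r - 2)).
Proof.
move=> r2; rewrite -(subnK r2) addnK addn2; move: (r - 2)%N => {r2} {}r.
set K := (fun t : R => _).
have D0 t : 1 + t * s != 0 -> derive1n 0 K t = k + m * t + t ^+ 2 * C * psi t by [].
have D1 t : 1 + t * s != 0 ->
    derive1n 1 K t = m + (2 * t * C * psi t - t ^+ 2 * C * s * psi t ^+ 2).
  apply: (derive1n_step D0
    (dF := fun t => m + (2 * t * C * psi t - t ^+ 2 * C * s * psi t ^+ 2))) => {}t t0.
  have := is_deriveD (is_deriveD (is_derive_cst k t 1)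
     (is_deriveM (is_derive_cst m t 1) (is_derive_id t 1)))
     (is_deriveM (is_deriveM (is_deriveX 2 (is_derive_id t 1)) (is_derive_cst C t 1))
       (is_derive_psi t0)).
  by move/is_derive_eq; apply; rewrite /GRing.scale /= !fctE; ring.
(* The terms psi - 2 t s psi^2 + t^2 s^2 psi^3 collapse to psi^3, because (1 + t s - t s)^2 = 1. *)
have D2 t : 1 + t * s != 0 -> derive1n 2 K t = 2 * C * psi t ^+ 3.
  apply: (derive1n_step D1 (dF := fun t => 2 * C * psi t ^+ 3)) => {}t t0.
  have := is_deriveD (is_derive_cst m t 1) (is_deriveB
    (is_deriveM (is_deriveM (is_deriveM (is_derive_cst (2 : R) t 1) (is_derive_id t 1))
      (is_derive_cst C t 1)) (is_derive_psi t0))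
    (is_deriveM (is_deriveM (is_deriveM (is_deriveX 2 (is_derive_id t 1)) (is_derive_cst C t 1))
      (is_derive_cst s t 1)) (is_derive_psiX 2 t0))).
  move/is_derive_eq; apply; rewrite /GRing.scale /= !fctE /psi.
  by field.
(* Differentiating [psi ^+ r.+3] yields -s and the factor r + 3, which turns (r + 2)! into (r +
   3)!. *)
have Dr : forall t, 1 + t * s != 0 ->
    derive1n r.+2 K t = r.+2`!%:R * C * (- s) ^+ r * psi t ^+ r.+3.
  elim: r => [|r IHr] t t0; first by rewrite D2 // expr0 mulr1.
  apply: (derive1n_step IHr
    (dF := fun t => r.+3`!%:R * C * (- s) ^+ r.+1 * psi t ^+ r.+4)) t0 => {}t t0.
  have := is_deriveM (is_derive_cst (r.+2`!%:R * C * (- s) ^+ r) t 1) (is_derive_psiX r.+3 t0).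
  move/is_derive_eq; apply; rewrite scaler0 addr0 /GRing.scale /=.
  by rewrite (factS r.+2) natrM (exprS (- s)); ring.
by rewrite Dr /psi ?mul0r ?addr0 ?oner_neq0 // invr1 expr1n mulr1 mulrA.
Qed.
End DerivativesInTime.

(** * Homogeneity of the integral under positive constants *)

Section IntegralScaling.
Context d (T : measurableType d) (R : realType) (mu : {measure set T -> \bar R}).
Implicit Types (D : set T) (f : T -> \bar R).
Import HBNNSimple.

(** Scaling by c sends simple functions below f to simple functions below c f, and the integrals are
    suprema over these. *)
Let le_integralZ (c : R) f : (0 < c)%R -> (forall x, 0 <= f x)%E ->
  (\int[mu]_x f x <= c^-1%:E * \int[mu]_x (c%:E * f x))%E.
Proof.
move=> c0 f0; have cf0 x : (0 <= c%:E * f x)%E by rewrite mule_ge0 // lee_fin ltW.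
rewrite [leLHS]ge0_integralTE //; apply: ge_ereal_sup => _ [h hf <-].
have -> : sintegral mu h = (c^-1%:E * sintegral mu (scale_nnsfun h (ltW c0)))%E.
  by rewrite sintegralrM muleA -EFinM mulVf ?mul1e // gt_eqF.
rewrite lee_pmul2l ?lte_fin ?invr_gt0 // ge0_integralTE //.
apply: ereal_sup_ubound; exists (scale_nnsfun h (ltW c0)) => // x.
by rewrite /= EFinM lee_pmul2l // ?lte_fin //; exact: hf.
Qed.

(** The two inequalities are [le_integralZ] for c and for its inverse. *)
Let integralZ_nonneg (c : R) f : (0 < c)%R -> (forall x, 0 <= f x)%E ->
  (\int[mu]_x (c%:E * f x) = c%:E * \int[mu]_x f x)%E.
Proof.
move=> c0 f0; apply/le_anti/andP; split.
  have := @le_integralZ c^-1 (fun x => c%:E * f x)%E.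
  rewrite invr_gt0 invrK c0 => /(_ isT) H.
  apply: le_trans (H _) _ => [x|]; first by rewrite mule_ge0 // lee_fin ltW.
  under eq_integral do rewrite muleA -EFinM mulVf ?gt_eqF // mul1e.
  by [].
rewrite -(@lee_pmul2l _ c^-1%:E) ?lte_fin ?invr_gt0 //.
by rewrite muleA -EFinM mulVf ?gt_eqF // mul1e; exact: le_integralZ.
Qed.

(* The library's integral is built from suprema over simple functions, hence is
   homogeneous even when f is not measurable. *)
Lemma integralZ_pos (c : R) D f : (0 < c)%R ->
  (\int[mu]_(x in D) (c%:E * f x) = c%:E * \int[mu]_(x in D) f x)%E.
Proof.
move=> c0; rewrite integral_mkcond [in RHS]integral_mkcond.
rewrite (_ : (fun x => _) \_ D = (fun x => c%:E * (f \_ D) x)%E); last first.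
  by apply/funext => x; rewrite /patch; case: ifP => // _; rewrite mule0.
move: (f \_ D) => {}f; rewrite integralE [in RHS]integralE.
rewrite ge0_funeposM ?ge0_funenegM ?(ltW c0) //.
rewrite !integralZ_nonneg //.
have : (0 <= \int[mu]_x f^\+ x)%E by exact: integral_ge0.
have : (0 <= \int[mu]_x f^\- x)%E by exact: integral_ge0.
case: (\int[mu]_x f^\- x)%E => [n||] // n0; case: (\int[mu]_x f^\+ x)%E => [p||] // p0.
- by symmetry; exact: muleBr.
- by symmetry; exact: muleBr.
- by symmetry; exact: muleBr.
(* Both parts are infinite: the difference takes the default value -oo, which multiplication by c >
   0 preserves. *)
- by rewrite gt0_muley ?lte_fin //= gt0_muleNy ?lte_fin.
Qed.

(** An infinite integral stays infinite after scaling by c > 0 and is read as 0 by [Rintegral], so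
    the identity holds in that case too. *)
Lemma RintegralZ_pos (c : R) D (f : T -> R) : 0 < c ->
  \int[mu]_(x in D) (c * f x) = c * \int[mu]_(x in D) f x.
Proof.
move=> c0; rewrite /Rintegral; under eq_integral do rewrite EFinM.
rewrite integralZ_pos //; case: (\int[mu]_(x in D) (f x)%:E)%E => [p||] /=.
- by [].
- by rewrite gt0_muley ?lte_fin //= mulr0.
- by rewrite gt0_muleNy ?lte_fin //= mulr0.
Qed.
End IntegralScaling.

(** * The orthogonal splitting into vertical and horizontal parts *)

Section Splitting.
Variables (R : realType) (k q : nat).
Variable g : 'M[R]_(k + q).
Hypotheses (gT : g^T = g) (g_pos : forall v, v != 0 -> 0 < ip g v v).

Local Notation vert := (vertical R k q).
Local Notation hor := (horizontal g).

Lemma unitmx_pos : g \in unitmx.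
Proof.
rewrite -row_free_unit -kermx_eq0; apply/negPn/negP => /rowV0Pn[v /sub_kermxP vg v0].
by have := g_pos v0; rewrite /ip vg mul0mx mxE ltxx.
Qed.

Lemma ip_vert_hor v y : (v <= vert)%MS -> (y <= hor)%MS -> ip g y v = 0.
Proof.
move=> /submxP[u ->] /sub_kermxP yg.
by rewrite /ip trmx_mul mulmxA -(mulmxA y) yg mul0mx mxE.
Qed.

Lemma cap_vert_hor : (vert :&: hor = 0)%MS.
Proof.
apply/eqP/negPn/negP => /rowV0Pn[v]; rewrite sub_capmx => /andP[vV vH] v0.
by have := g_pos v0; rewrite ip_vert_hor ?ltxx.
Qed.

(** A dimension count: g is invertible, so the kernel defining [horizontal] has the dimension
    complementary to that of [vertical]. *)
Lemma add_vert_hor : (1%:M <= vert + hor)%MS.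
Proof.
rewrite sub1mx /row_full mxrank_disjoint_sum ?cap_vert_hor // mxrank_ker.
have -> : \rank (g *m vert^T) = \rank vert.
  by rewrite -mxrank_tr trmx_mul trmxK gT mxrankMfree // row_free_unit unitmx_pos.
by rewrite subnKC // rank_leq_row.
Qed.

Lemma proj_vert_hor :
  proj_mx vert hor + proj_mx hor vert = 1%:M.
Proof.
by have := add_proj_mx cap_vert_hor add_vert_hor; rewrite !mul1mx.
Qed.

Let PV := proj_mx vert hor.
Let PH := proj_mx hor vert.

Let cross m m' (A : 'M[R]_(m, k + q)) (B : 'M[R]_(m', k + q)) :
  (A <= vert)%MS -> (B <= hor)%MS -> A *m g *m B^T = 0.
Proof.
move=> /submxP[D ->] /sub_kermxP Bg.
apply: trmx_inj; rewrite !trmx_mul trmxK gT trmx0.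
by rewrite !mulmxA -(mulmxA B) Bg mul0mx.
Qed.

Let PV_vert : (PV <= vert)%MS.
Proof. by rewrite -[PV]mul1mx proj_mx_sub. Qed.

Let PH_hor : (PH <= hor)%MS.
Proof. by rewrite -[PH]mul1mx proj_mx_sub. Qed.

(** Replacing the right factor [PV^T] by [(PV + PH)^T], the identity, adds a mixed term that is zero
    by orthogonality. *)
Lemma vpartE : vpart g = PV *m g.
Proof.
rewrite -[PV *m g]mulmx1 -[1%:M in RHS]trmx1 -proj_vert_hor linearD /= mulmxDr.
by rewrite -/PH (cross PV_vert PH_hor) addr0.
Qed.

Let trmx_congruence (P : 'M[R]_(k + q)) : (P *m g *m P^T)^T = P *m g *m P^T.
Proof. by rewrite !trmx_mul trmxK gT mulmxA. Qed.

Lemma trmx_vpart : (vpart g)^T = vpart g.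
Proof. exact: trmx_congruence. Qed.

Lemma hpartD_vpart : hpart g + vpart g = g.
Proof.
have hE : hpart g = PH *m g.
  rewrite -[PH *m g]mulmx1 -[1%:M in RHS]trmx1 -proj_vert_hor linearD /= mulmxDr.
  have -> : PH *m g *m PV^T = (PV *m g *m PH^T)^T.
    by move: PV PH => A B; rewrite !trmx_mul trmxK gT mulmxA.
  by rewrite (cross PV_vert PH_hor) trmx0 add0r.
by rewrite hE vpartE -mulmxDl addrC proj_vert_hor mul1mx.
Qed.

Lemma vpart_vert m (w : 'M[R]_(m, k + q)) : (w <= vert)%MS -> w *m vpart g = w *m g.
Proof. by move=> wV; rewrite vpartE mulmxA proj_mx_id ?cap_vert_hor. Qed.

Lemma vpart_hor m (y : 'M[R]_(m, k + q)) : (y <= hor)%MS -> y *m vpart g = 0.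
Proof. by move=> yH; rewrite vpartE mulmxA proj_mx_0 ?cap_vert_hor // mul0mx. Qed.

Lemma ip_vpart_ge0 y : 0 <= ip (vpart g) y y.
Proof.
have -> : ip (vpart g) y y = ip g (y *m PV) (y *m PV).
  rewrite /vpart -/PV; move: PV => P.
  by rewrite /ip trmx_mul !mulmxA.
have [->|/g_pos/ltW//] := eqVneq (y *m PV) 0.
by rewrite /ip mul0mx mul0mx mxE.
Qed.

(** A basis of the leaf directions with full row rank, so that its Gram matrix is invertible,
    whereas the square matrix [vertical] has rank k. *)
Let U : 'M[R]_(k, k + q) := row_mx 1%:M 0.

Lemma row_vertical : (U :=: vert)%MS.
Proof.
rewrite /vertical pid_mx_block block_mxEv row_mx0.
by apply: eqmx_trans (addsmxE _ _); apply: eqmx_sym; exact: addsmx0.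
Qed.

Lemma unitmx_gram : U *m g *m U^T \in unitmx.
Proof.
rewrite -row_free_unit -kermx_eq0; apply/negPn/negP => /rowV0Pn[v /sub_kermxP vg v0].
have : v *m U != 0.
  apply: contra_neq v0 => /(congr1 (mulmx^~ U^T)).
  by rewrite mul0mx -mulmxA tr_row_mx mul_row_col trmx1 mulmx1 trmx0 mulmx0 addr0 mulmx1.
by move/g_pos; rewrite /ip trmx_mul mulmxA -(mulmxA v) -(mulmxA v) vg mul0mx mxE ltxx.
Qed.

(** Built from products and one inverse in g, this form shows that the vertical part inherits the
    regularity of g, which [proj_mx] does not. The two sides are compared on each summand of the
    splitting. *)
Lemma vpart_gram : vpart g = g *m U^T *m invmx (U *m g *m U^T) *m (U *m g).
Proof.
set W := RHS; rewrite -[LHS]mul1mx -[RHS]mul1mx -proj_vert_hor !mulmxDl.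
have VW : U *m W = U *m g.
  by rewrite /W !mulmxA mulmxV ?unitmx_gram // mul1mx.
have /submxP[D PVE] : (PV <= U)%MS by rewrite row_vertical.
have /submxP[D' UE] : (U <= vert)%MS by rewrite row_vertical.
have /sub_kermxP PHE := PH_hor.
congr (_ + _).
  by rewrite -/PV PVE -!mulmxA VW vpart_vert // row_vertical.
rewrite vpart_hor //.
by rewrite /W UE trmx_mul !mulmxA -(mulmxA PH) PHE !mul0mx.
Qed.

End Splitting.

(** * Directional derivatives, minima and exponentials *)

Section LocalCalculus.
Variable R : realType.

Lemma open_obox n (lo hi : 'rV[R]_n) : open (obox lo hi).
Proof.
rewrite openE => x xb.
have near_coord j : \forall y \near x, lo 0 j < (y : 'rV[R]_n) 0 j < hi 0 j.
  have /andP[l h] := xb j.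
  have cj : (fun y : 'rV[R]_n => y 0 j) @ x --> x 0 j by exact: coord_continuous.
  by apply: filterS2 (cvgr_gt _ cj _ l) (cvgr_lt _ cj _ h) => y ly yh; rewrite ly yh.
exact: (filter_forall (nbhs_filter x) near_coord).
Qed.

Lemma near_line (V : normedModType R) (x w : V) (P : set V) :
  (\near x, P x) -> \forall s \near (0 : R), P (s *: w + x).
Proof.
move=> Px; have : (fun s : R => s *: w + x) @ (0 : R) --> 0 *: w + x.
  by apply: cvgD; [apply: cvgZ; [exact: cvg_id | exact: cvg_cst] | exact: cvg_cst].
by rewrite scale0r add0r; apply.
Qed.

Lemma derive_const_line (V : normedModType R) (h : V -> R) (x w : V) :
  (\forall s \near (0 : R), h (s *: w + x) = h x) -> 'D_w h x = 0.
Proof.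
move=> hc; apply: cvg_lim => //.
apply: (@cvg_trans _ ((fun=> 0) @ (0 : R)^')); last exact: cvg_cst.
apply: near_eq_cvg; apply: cvg_within.
by apply: filterS hc => s /= ->; rewrite subrr scaler0.
Qed.

(** Right difference quotients at a minimum are nonnegative, hence so are the derivatives along v
    and -v, which are opposite by linearity of the differential. *)
Lemma derive_local_min (V : normedModType R) (h : V -> R) (x v : V) :
  differentiable h x -> (\forall y \near x, h x <= h y) -> 'D_v h x = 0.
Proof.
move=> dh hmin; have ge0 w : 0 <= 'D_w h x.
  have dw : derivable h x w by exact: diff_derivable.
  rewrite ['D_w h x]cvg_at_rightE //; apply: limr_ge.
    rewrite -(cvg_at_rightE (fun s : R => s^-1 *: ((h \o shift x) _ - h x))) //.
    apply: cvg_trans dw; apply: cvg_app => A [e e0 Ae].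
    by exists e => // y ye y0; apply: Ae => //; exact: lt0r_neq0.
  have hs : \forall s \near (0 : R)^'+, h x <= h (s *: w + x).
    by rewrite near_withinE; apply: filterS (near_line w hmin).
  near=> s; apply: mulr_ge0; first by rewrite invr_ge0 ltW.
  by rewrite subr_ge0; near: s.
apply/le_anti/andP; split => //.
have -> : 'D_v h x = - 'D_(- v) h x by rewrite !deriveE // linearN opprK.
by rewrite oppr_le0.
Unshelve. all: by end_near. Qed.

Lemma derive_comp (V W : normedModType R) (h : W -> R) (c : V -> W) (u d : V) :
  differentiable c u -> differentiable h (c u) ->
  'D_d (h \o c) u = 'D_('D_d c u) h (c u).
Proof.
move=> dc dh; rewrite !deriveE //; last exact: differentiable_comp.
by rewrite diff_comp.
Qed.

Lemma differentiable_expR (r : R) : differentiable (@expR R) r.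
Proof. exact/derivable1_diffP/derivable_expR. Qed.

Lemma differentiable_expR_comp (V : normedModType R) (h : V -> R) (x : V) :
  differentiable h x -> differentiable (fun y => expR (h y)) x.
Proof. by move=> dh; exact: (differentiable_comp dh (differentiable_expR (h x))). Qed.

Lemma derive_expR_comp (V : normedModType R) (h : V -> R) (x v : V) :
  differentiable h x -> 'D_v (fun y => expR (h y)) x = expR (h x) * 'D_v h x.
Proof.
move=> dh; have dE := differentiable_expR (h x).
rewrite (derive_comp v dh dE); move: ('D_v h x) => z.
have -> : 'D_z expR (h x) = z *: 'D_(1 : R) expR (h x).
  by rewrite !(deriveE _ dE) -linearZ /= [z *: 1]mulr1.
by have [_ ->] := is_derive_expR (h x); rewrite /GRing.scale /= mulrC.
Qed.

Lemma C2_at_expR (V : normedModType R) (h : V -> R) (x : V) :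
  C2_at h x -> C2_at (fun y => expR (h y)) x.
Proof.
move=> Ch; have dh0 := C2_at_diff Ch; case: Ch => dh d2h.
split=> [|v]; first by apply: filterS dh => y; exact: differentiable_expR_comp.
apply: (@near_eq_differentiable _ _ _ (fun y => expR (h y) * 'D_v h y)).
  by apply: filterS dh => y dhy; rewrite derive_expR_comp.
exact: (differentiableM (differentiable_expR_comp dh0) (d2h v)).
Qed.

End LocalCalculus.

(** * Vertical vectors and functions constant on plaques *)

Section Vertical.
Variables (R : realType) (k q : nat).

Lemma sub_vertical (w : 'rV[R]_(k + q)) :
  (w <= vertical R k q)%MS <-> rsubmx w = 0.
Proof.
split=> [|w0].
  rewrite -row_vertical => /submxP[u ->].
  by rewrite mul_mx_row row_mxKr mulmx0.
rewrite -row_vertical; apply/submxP; exists (lsubmx w).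
by rewrite mul_mx_row mulmx1 mulmx0 -w0 hsubmxK.
Qed.

Lemma rsubmx_line (x w : 'rV[R]_(k + q)) (s : R) :
  (w <= vertical R k q)%MS -> rsubmx (s *: w + x) = rsubmx x.
Proof. by move=> /sub_vertical w0; rewrite linearD linearZ /= w0 scaler0 add0r. Qed.

(** Verticality means that the last q coordinates vanish, a linear condition with constant
    coefficients. *)
Lemma derive_vertical (V : normedModType R) (Y : V -> 'rV[R]_(k + q)) u d :
  derivable Y u d -> (\forall u' \near u, (Y u' <= vertical R k q)%MS) ->
  ('D_d Y u <= vertical R k q)%MS.
Proof.
move=> dY Yv; apply/sub_vertical/rowP => j; rewrite derive_mx // !mxE.
rewrite (@near_eq_derive _ _ _ _ (cst 0)) ?derive_cst //.
apply: filterS Yv => u' /sub_vertical/rowP/(_ j).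
by rewrite !mxE.
Qed.

Lemma derive_leaf (O : set 'rV[R]_(k + q)) (h : 'rV[R]_(k + q) -> R) x w :
  open O -> O x -> (forall y, O y -> rsubmx y = rsubmx x -> h y = h x) ->
  (w <= vertical R k q)%MS -> 'D_w h x = 0.
Proof.
move=> Oop Ox hx wV; apply: derive_const_line.
have On : nbhs x O by exact: open_nbhs_nbhs.
by apply: filterS (near_line w On) => s Os; apply: hx; rewrite // rsubmx_line.
Qed.

(** N is the gradient of E, that is dE times the inverse of g; it is orthogonal to the leaf because
    dE vanishes on vertical vectors. *)
Lemma horizontal_gradient (g : 'M[R]_(k + q)) (E : 'rV[R]_(k + q) -> R) x :
  g \in unitmx -> differentiable E x ->
  (forall w, (w <= vertical R k q)%MS -> 'D_w E x = 0) ->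
  exists2 N : 'rV[R]_(k + q), forall l, 'D_l E x = ip g N l
                            & (N <= horizontal g)%MS.
Proof.
move=> gU dE Ev; pose r : 'rV[R]_(k + q) := \row_j 'D_(delta_mx 0 j) E x.
have rE l : 'D_l E x = (r *m l^T) 0 0.
  rewrite derive_row_sum // mxE; apply: eq_bigr => j _.
  by rewrite !mxE mulrC.
exists (r *m invmx g) => [l|]; first by rewrite /ip mulmxKV.
apply/sub_kermxP; rewrite mulmxA mulmxKV //; apply/rowP => j; rewrite [RHS]mxE.
have := Ev (row j (vertical R k q)) (row_sub _ _); rewrite rE => <-.
by rewrite !mxE; apply: eq_bigr => l _; rewrite !mxE.
Qed.

End Vertical.

(** * Koszul symbols of the vertical part of a bundle-like metric *)

Section PointSetup.
Variables (R : realType) (k q : nat).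
Local Notation n := (k + q).
Variables (O : set 'rV[R]_n) (g : 'rV[R]_n -> 'M[R]_n).
Hypotheses (O_open : open O) (g_smooth : smooth_map_on O g).
Hypothesis gT : forall x, O x -> (g x)^T = g x.
Hypothesis g_pos : forall x v, O x -> v != 0 -> 0 < ip (g x) v v.
Hypothesis g_bundle_like : forall x x', O x -> O x' -> rsubmx x = rsubmx x' ->
  hpart (g x) = hpart (g x').

Local Notation V := (fun x => vpart (g x)).

Let near_O x : O x -> \forall y \near x, O y.
Proof. by move=> Ox; exact: open_nbhs_nbhs. Qed.

Lemma C2_mx_metric x : O x -> C2_mx g x.
Proof. exact: smooth_on_C2_mx. Qed.

Lemma C2_mx_vpart x : O x -> C2_mx V x.
Proof.
move=> Ox; pose U : 'M[R]_(k, n) := row_mx 1%:M 0.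
have CU := C2_mx_cst U x; have CUT := C2_mx_cst U^T x; have Cg := C2_mx_metric Ox.
apply: (@near_eq_C2_mx _ _ _ _ (fun y => g y *m U^T *m invmx (U *m g y *m U^T) *m (U *m g y))).
  apply: filterS (near_O Ox) => y Oy; rewrite vpart_gram // => [|v v0].
    exact: gT.
  exact: g_pos.
apply: C2_mxM (C2_mxM CU Cg); apply: C2_mxM (C2_mxM Cg CUT) _.
apply: (C2_mx_inv (C2_mxM (C2_mxM CU Cg) CUT)).
by apply: unitmx_gram => v; exact: g_pos.
Qed.

Lemma near_trmx_vpart x : O x -> \forall y \near x, (V y)^T = V y.
Proof. by move=> Ox; apply: filterS (near_O Ox) => y Oy; apply: trmx_vpart; exact: gT. Qed.

(* V(w, .) = g(w, .) for vertical w, and g - V = H is constant along w. *)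
Lemma koszul_vpart_vert x z w l : O x -> (w <= vertical R k q)%MS ->
  koszul V z w l x = koszul g z w l x.
Proof.
move=> Ox wV; have On := near_O Ox.
have dg := nbhs_singleton (near_differentiable_ip (C2_mx_metric Ox)).
have dV := nbhs_singleton (near_differentiable_ip (C2_mx_vpart Ox)).
have Vw y p : O y -> ip (V y) w p = ip (g y) w p.
  move=> Oy; rewrite /ip vpart_vert //; [exact: gT | by move=> u; exact: g_pos].
have Vw' y p : O y -> ip (V y) p w = ip (g y) p w.
  move=> Oy; rewrite (ip_sym _ _ (gT Oy)) -Vw // ip_sym //.
  by apply: trmx_vpart; exact: gT.
have e1 : 'D_z (fun y => ip (V y) w l) x = 'D_z (fun y => ip (g y) w l) x.
  by apply: near_eq_derive; apply: filterS On => y; exact: Vw.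
have e2 : 'D_l (fun y => ip (V y) z w) x = 'D_l (fun y => ip (g y) z w) x.
  by apply: near_eq_derive; apply: filterS On => y; exact: Vw'.
have e3 : 'D_w (fun y => ip (V y) z l) x = 'D_w (fun y => ip (g y) z l) x.
  apply/esym/eqP; rewrite -subr_eq0 -deriveB; [|exact: diff_derivable..].
  apply/eqP/derive_const_line; apply: filterS (near_line w On) => s Os.
  have HE y : O y -> ip (g y) z l - ip (V y) z l = ip (hpart (g y)) z l.
    move=> Oy; rewrite -{1}(hpartD_vpart (gT Oy)) => [|u]; last exact: g_pos.
    by rewrite ip_addmx addrK.
  apply: etrans (HE _ Os) _; apply: etrans (esym (HE _ Ox)).
  by rewrite (g_bundle_like Os Ox) // rsubmx_line.
by rewrite /koszul e1 e2 e3.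
Qed.

(* V(X, .) vanishes along c, and V(X u, X u) >= 0 has a minimum at c u. *)
Lemma koszul_vpart_hor (W : normedModType R) (c X : W -> 'rV[R]_n) u d l :
  O (c u) -> differentiable c u -> derivable X u d -> 'D_d c u = X u ->
  (\forall u' \near u, (X u' <= horizontal (g (c u')))%MS) ->
  koszul V (X u) (X u) l (c u) = - ip (V (c u)) ('D_d X u) l.
Proof.
move=> Oc dc dX cX Xh; set x := c u; set v := X u.
have dV := nbhs_singleton (near_differentiable_ip (C2_mx_vpart Oc)).
have vpos y p : O y -> p != 0 -> 0 < ip (g y) p p by move=> Oy; exact: g_pos.
have On : \forall u' \near u, O (c u').
  by apply: (differentiable_continuous dc); exact: near_O.
have Vv p : ip (V x) v p = 0.
  rewrite /ip vpart_hor ?mul0mx ?mxE //; first exact: gT.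
    by move=> ?; exact: vpos.
  exact: nbhs_singleton Xh.
have min0 : 'D_l (fun y => ip (V y) v v) x = 0.
  apply: derive_local_min => //; apply: filterS (near_O Oc) => y Oy.
  by rewrite Vv ip_vpart_ge0 // => ?; exact: vpos.
have dVc : is_derive u d (fun u' => V (c u')) ('D_d (fun u' => V (c u')) u).
  apply: derivableP; apply/derivable_mxP => i j; apply: diff_derivable.
  have dVij : differentiable (fun y => V y i j) (c u) by exact/C2_at_diff/C2_mx_vpart.
  exact: (differentiable_comp dc dVij).
have chain p r : 'D_v (fun y => ip (V y) p r) x = ip ('D_d (fun u' => V (c u')) u) p r.
  have := is_derive_ip dVc (is_derive_cst p u d) (is_derive_cst r u d).
  rewrite ip0l ip0r !addr0 => -[_ <-].
  by rewrite /v -cX -derive_comp.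
(* Differentiating V(X, l) = 0 along c expresses the derivative of V on (X, l) as -V(D_d X, l). The
   first two Koszul terms both have this value, and the third is zero by [min0]. *)
have D0 : 'D_d (fun u' => ip (V (c u')) (X u') l) u = 0.
  rewrite (@near_eq_derive _ _ _ _ (cst 0)) ?derive_cst //.
  apply: filterS2 On Xh => u' Ou' Xu'.
  rewrite /ip vpart_hor ?mul0mx ?mxE //; first exact: gT.
  by move=> ?; exact: vpos.
have := is_derive_ip dVc (derivableP dX) (is_derive_cst l u d).
rewrite ip0r addr0 => -[_]; rewrite D0 => /esym/eqP.
rewrite addr_eq0 => /eqP D1.
by rewrite /koszul min0 !chain D1; field.
Qed.

End PointSetup.

(** * The curvature derivatives at a point of the torus *)

Lemma C2_at_id (R : realType) (x : R) : C2_at (fun y : R => y) x.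
Proof.
split=> [|v]; first by near=> y.
rewrite (_ : (fun y => _) = cst v) ?funeqE => [|y]; last exact: derive_id.
exact: differentiable_cst.
Unshelve. all: by end_near. Qed.

(** On D the pushed field is the sum of the components of a times the partial derivatives of c, and
    every factor is differentiable. *)
Lemma derivable_push_smooth (R : realType) m n (D : set 'rV[R]_m)
    (c : 'rV[R]_m -> 'rV[R]_n) (a : 'rV[R]_m -> 'rV[R]_m) u d :
  open D -> smooth_map_on D c -> smooth_map_on setT a -> D u ->
  derivable (fun u' => 'D_(a u') c u') u d.
Proof.
move=> Dop cD aT Du; apply/derivable_mxP => i j.
have [ca cc] : (forall l, differentiable (fun u' => a u' 0 l) u) /\
    (forall l, differentiable (partial l (fun u' => c u' i j)) u).
  by split=> l; [exact: (aT 0 l [::]) | exact: (cD i j [:: l])].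
apply: (@near_eq_derivable _ _ _
    (\sum_l (fun u' => a u' 0 l * partial l (fun u' => c u' i j) u'))).
  have Dn : nbhs u D by exact: open_nbhs_nbhs.
  apply: filterS Dn => u' Du'; rewrite fct_sumE.
  have dc : derivable c u' (a u') by apply: C2_mx_derivable; exact: (smooth_on_C2_mx Dop cD Du').
  by rewrite derive_mx // mxE (derive_row_sum _ (cD i j [::] u' Du')).
apply: diff_derivable; apply: differentiable_sum => l.
exact: (differentiableM (ca l) (cc l)).
Qed.

Section TorusPoint.
Variables (R : realType) (k q : nat) (M : topologicalType).
Variable F : foliated_atlas R k q M.
Variable g0 : metric F.
Hypotheses (g0_riem : riemannian g0) (g0_bundle_like : bundle_like g0).
Variable tau : 'rV[R]_2 -> M.
Hypothesis tau_torus : embedded_torus F tau.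
Variables a b : 'rV[R]_2 -> 'rV[R]_2.
Hypotheses (a_field : torus_field a) (b_field : torus_field b).
Hypothesis X_horizontal : forall (i : chart F) (u : 'rV[R]_2), dom i (tau u) ->
  (push tau a i u <= horizontal (g0 i (read tau i u)))%MS.
Hypothesis Y_vertical : forall (i : chart F) (u : 'rV[R]_2), dom i (tau u) ->
  (push tau b i u <= vertical R k q)%MS.
Hypothesis nabla_XX : forall (i : chart F) (u : 'rV[R]_2), dom i (tau u) ->
  torus_cov g0 tau a a i u = 0.
Hypothesis nabla_XY : forall (i : chart F) (u : 'rV[R]_2), dom i (tau u) ->
  torus_cov g0 tau a b i u = 0.
Hypothesis nabla_YY : forall (i : chart F) (u : 'rV[R]_2), dom i (tau u) ->
  torus_cov g0 tau b b i u = 0.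
Variable f : M -> R.
Hypotheses (f_smooth : smooth_fun F f) (f_basic : basic F f).

Local Notation n := (k + q).

Lemma derive1n_torus_curv (u : 'rV[R]_2) r : (2 <= r)%N ->
  derive1n r (fun t => torus_curv (segment g0 (warped f g0) t) tau a b u) 0 =
  r`!%:R * (expR (4 * f (tau u)) * (1 - expR (2 * f (tau u))) ^+ (r - 2)
          * torus_sqnorm g0 tau b (torus_df F f tau a u) u).
Proof.
move=> r2; rewrite /torus_curv /torus_sqnorm /torus_df.
set i := chart_at F (tau u); have Du : dom i (tau u) by exact: mem_chart_at.
set c := read tau i; set x := c u; set v := push tau a i u; set w := push tau b i u.
have [g_smooth gT g_pos _] := g0_riem; have [tau_cts _ c_smooth _] := tau_torus.
have Oop : open (img i) by exact: open_obox.
have Dop : open (tau @^-1` dom i) by apply: open_comp (dom_open i) => ? _; exact: tau_cts.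
have Dn : nbhs u (tau @^-1` dom i) by exact: open_nbhs_nbhs.
have img_c u' : dom i (tau u') -> img i (c u') by exact: chart_map_box.
have Ox : img i x by exact: img_c.
have On : nbhs x (img i) by exact: open_nbhs_nbhs.
have gu : g0 i x \in unitmx by apply: unitmx_pos => z; exact: g_pos.
pose V y := vpart (g0 i y); pose E y := expR (2 * f (chart_inv i y)) - 1.
have Cg : C2_mx (g0 i) x by exact: (C2_mx_metric Oop (g_smooth i) Ox).
have CV : C2_mx V x by apply: (C2_mx_vpart Oop (g_smooth i) (gT i)) => // *; exact: g_pos.
have Cf : C2_at (f \o chart_inv i) x by exact: (smooth_on_C2_at Oop (@f_smooth i) Ox).
have C2f : C2_at (fun y => 2 * f (chart_inv i y)) x.
  exact: (C2_atM (C2_at_cst 2 x) Cf).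
have CE : C2_at E x by apply: (C2_atD (C2_at_expR C2f) (C2_at_cst _ _)).
have dc : differentiable c u.
  by apply: differentiable_mx => i' j'; exact: (c_smooth i i' j' [::]).
have dX d : derivable (push tau a i) u d.
  exact: (derivable_push_smooth Dop (c_smooth i) a_field.1 Du).
have dY d : derivable (push tau b i) u d.
  exact: (derivable_push_smooth Dop (c_smooth i) b_field.1 Du).
(* A vanishing covariant derivative trades the Christoffel symbol for minus the derivative of the
   field, which depends only on values along the torus. *)
have covE a' b' : torus_cov g0 tau a' b' i u = 0 ->
    'D_(a' u) (push tau b' i) u
    = - christoffel (g0 i) x (push tau a' i u) (push tau b' i u).
  by move/eqP; rewrite addr_eq0 => /eqP.
have XXE := covE _ _ (nabla_XX Du); have XYE := covE _ _ (nabla_XY Du).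
have YYE := covE _ _ (nabla_YY Du).
have Yn : \forall u' \near u, (push tau b i u' <= vertical R k q)%MS.
  by apply: filterS Dn => u'; exact: Y_vertical.
have wV : (w <= vertical R k q)%MS by exact: Y_vertical.
have vH : (v <= horizontal (g0 i x))%MS by exact: X_horizontal.
have fleaf y : img i y -> rsubmx y = rsubmx x -> f (chart_inv i y) = f (chart_inv i x).
  move=> Oy yx; apply: f_basic; apply: (same_plaque (i := i)); rewrite ?chart_invK //.
    exact: chart_inv_dom.
  exact: chart_inv_dom.
have Eleaf z : (z <= vertical R k q)%MS -> 'D_z E x = 0.
  by apply: (derive_leaf Oop Ox) => y Oy yx; rewrite /E fleaf.
have [N NE NH] := horizontal_gradient gu (C2_at_diff CE) Eleaf.
have posx z : z != 0 -> 0 < ip (g0 i x) z z by exact: g_pos.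
have hV (z : 'rV_n) : (z <= horizontal (g0 i x))%MS -> z *m V x = 0.
  by move=> zH; apply: vpart_hor; [exact: gT | exact: posx | ].
have vV (z : 'rV_n) : (z <= vertical R k q)%MS -> z *m V x = z *m g0 i x.
  by move=> zV; apply: vpart_vert; [exact: gT | exact: posx | ].
have dg := nbhs_singleton (near_differentiable_ip Cg).
have Pver z l : (christoffel (g0 i) x z w <= vertical R k q)%MS ->
    koszul V z w l x = ip (V x) (christoffel (g0 i) x z w) l.
  move=> zV; rewrite (koszul_vpart_vert Oop (g_smooth i) (gT i) (g_pos i)) //; last first.
    by move=> y y' Oy Oy'; exact: g0_bundle_like.
  by rewrite -(ip_christoffel _ _ _ dg gu) /ip vV.
(* A field that stays vertical along the torus has vertical derivative, hence by [covE] a vertical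
   Christoffel symbol, on which V and g0 agree. *)
have chr_vert a' b' : torus_cov g0 tau a' b' i u = 0 ->
    (\forall u' \near u, (push tau b' i u' <= vertical R k q)%MS) ->
    derivable (push tau b' i) u (a' u) ->
    (christoffel (g0 i) x (push tau a' i u) (push tau b' i u) <= vertical R k q)%MS.
  move=> /covE D Vn dD; have := derive_vertical dD Vn; rewrite D.
  by rewrite -scaleN1r => /(scalemx_sub (-1)); rewrite scalerA mulrNN mul1r scale1r.
have Pvw l := Pver v l (chr_vert _ _ (nabla_XY Du) Yn (dY _)).
have Pww l := Pver w l (chr_vert _ _ (nabla_YY Du) Yn (dY _)).
have Pvv l : koszul V v v l x = ip (V x) (christoffel (g0 i) x v v) l.
  rewrite (koszul_vpart_hor Oop (g_smooth i) (gT i) (g_pos i) (c := c) (X := push tau a i) (d := a u)) //.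
    by rewrite XXE ipNl opprK.
  by apply: filterS Dn => u'; exact: X_horizontal.
pose G t := segment g0 (warped f g0) t i.
(* Replacing g0 by H + V turns the interpolation into adding t E V. *)
have GE t : \forall y \near x, G t y = g0 i y + t *: (E y *: V y).
  apply: filterS On => y Oy; rewrite /G /segment /warped /E /V.
  have gE : hpart (g0 i y) + vpart (g0 i y) = g0 i y.
    by apply: hpartD_vpart; [exact: gT | move=> z; exact: g_pos].
  move: (hpart (g0 i y)) (vpart (g0 i y)) (expR _) gE => A B e <-.
  by apply/matrixP => p p'; rewrite !mxE; ring.
have [k1 [m1 KE]] := curv_warped Cg CV CE gu
  (filterS (gT i) On) (near_trmx_vpart Oop (gT i) Ox) GE (hV _ vH) (vV _ wV)
  Pvv Pvw Pww (Eleaf _ wV) NE (hV _ NH).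
(* For derivatives at t = 0 the closed formula is wanted for t near 0, where 1 + t E and the
   determinant of the metric are nonzero by continuity. *)
have ctsE : (fun t : R => 1 + t * E x) @ (0 : R) --> 1 + 0 * E x.
  by apply: cvgD; [exact: cvg_cst | apply: cvgM; [exact: cvg_id | exact: cvg_cst]].
have t_phi : \forall t \near (0 : R), 1 + t * E x != 0.
  by apply: (cvgr_neq0 _ ctsE); rewrite mul0r addr0 oner_neq0.
have t_unit : \forall t \near (0 : R), G t x \in unitmx.
  have CGt : C2_mx (fun t : R => g0 i x + t *: (E x *: V x)) 0.
    move=> p p'; under eq_fun do rewrite !mxE.
    apply: C2_atD; first exact: C2_at_cst.
    by apply: C2_atM; [exact: C2_at_id | exact: C2_at_cst].
  apply: filterS (near_unitmx CGt _) => [t|]; last by rewrite scale0r addr0.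
  by rewrite (nbhs_singleton (GE t)).
rewrite (@near_eq_derive1n _ _ (fun t => k1 + m1 * t
  + t ^+ 2 * ('D_v E x ^+ 2 * ip (g0 i x) w w / 4) / (1 + t * E x))); last first.
  by apply: filterS2 t_unit t_phi => t; exact: KE.
rewrite derive1n_warped_curvature //; congr (_ * _).
(* As dE(X) = 2 e^{2f} df(X), the factor 1/4 cancels and dE(X)^2 contributes e^{4f}; the powers of
   -E are those of 1 - e^{2f}. *)
have dE : 'D_v E x = expR (2 * f (tau u)) * (2 * 'D_v (f \o chart_inv i) x).
  have dEx := differentiable_expR_comp (C2_at_diff C2f).
  have -> : 'D_v E x = 'D_v (fun y => expR (2 * f (chart_inv i y))) x - 0.
    rewrite -[X in _ - X](derive_cst (1 : R) x v) -deriveB //.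
    exact: diff_derivable.
  rewrite subr0 derive_expR_comp; last exact: C2_at_diff C2f.
  rewrite /x /c /read /= chart_mapK //; congr (_ * _).
  exact: (deriveZ 2 (diff_derivable (C2_at_diff Cf))).
have Ex : E x = expR (2 * f (tau u)) - 1 by rewrite /E /x /c /read /= chart_mapK.
have e4 : expR (4 * f (tau u)) = expR (2 * f (tau u)) ^+ 2.
  by rewrite -expRM_natl; congr expR; ring.
rewrite dE Ex opprB ipZl ipZr e4.
move: (expR _) ('D_v _ x) (ip _ _ _) (_ ^+ (r - 2)) => e d p z.
by field.
Qed.

End TorusPoint.

(** * Integration over the torus *)

Lemma torus_integralZ (R : realType) (k q : nat) (M : topologicalType)
    (F : foliated_atlas R k q M) (g : metric F) tau (c : R) h : 0 < c ->
  torus_integral g tau (fun u => c * h u) = c * torus_integral g tau h.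
Proof.
move=> c0; rewrite /torus_integral -RintegralZ_pos //; congr (Rintegral _ _ _).
by apply/funext => z; rewrite mulrA.
Qed.

Theorem proposition2 (R : realType) (k q : nat) (M : topologicalType)
    (M_hausdorff : hausdorff_space M) (M_compact : compact [set: M])
    (F : foliated_atlas R k q M)
    (g0 : metric F) (g0_riem : riemannian g0) (g0_bundle_like : bundle_like g0)
    (tau : 'rV[R]_2 -> M) (tau_torus : embedded_torus F tau)
    (tau_geodesic : totally_geodesic g0 tau) (tau_flat : flat g0 tau)
    (a b : 'rV[R]_2 -> 'rV[R]_2)
    (a_field : torus_field a) (b_field : torus_field b)
    (X_horizontal : forall (i : chart F) (u : 'rV[R]_2), dom i (tau u) ->
      (push tau a i u <= horizontal (g0 i (read tau i u)))%MS)
    (Y_vertical : forall (i : chart F) (u : 'rV[R]_2), dom i (tau u) ->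
      (push tau b i u <= vertical R k q)%MS)
    (XY_span : forall (i : chart F) (u : 'rV[R]_2), dom i (tau u) ->
      (col_mx (push tau a i u) (push tau b i u) == 'J (read tau i) u)%MS)
    (nabla_XX : forall (i : chart F) (u : 'rV[R]_2), dom i (tau u) ->
      torus_cov g0 tau a a i u = 0)
    (nabla_XY : forall (i : chart F) (u : 'rV[R]_2), dom i (tau u) ->
      torus_cov g0 tau a b i u = 0)
    (nabla_YY : forall (i : chart F) (u : 'rV[R]_2), dom i (tau u) ->
      torus_cov g0 tau b b i u = 0)
    (f : M -> R) (f_smooth : smooth_fun F f) (f_basic : basic F f) :
  let g (t : R) : metric F := segment g0 (warped f g0) t in
  let K (t : R) (u : 'rV[R]_2) : R := torus_curv (g t) tau a b u in
  (forall u : 'rV[R]_2, derive1n 1 (K ^~ u) 0 = 0) ->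
  forall r : nat, (2 <= r)%N ->
    0 < torus_integral g0 tau (fun u => derive1n r (K ^~ u) 0)
    <->
    0 < torus_integral g0 tau (fun u =>
          expR (4 * f (tau u)) * (1 - expR (2 * f (tau u))) ^+ (r - 2)
          * torus_sqnorm g0 tau b (torus_df F f tau a u) u).
Proof.
move=> g K _ r r2; have r0 : (0 : R) < r`!%:R by rewrite ltr0n fact_gt0.
(* The integrands agree at every point up to the constant r! > 0, so the two integrals have the same
   sign. *)
have -> : (fun u => derive1n r (K ^~ u) 0) = (fun u => r`!%:R *
    (expR (4 * f (tau u)) * (1 - expR (2 * f (tau u))) ^+ (r - 2)
     * torus_sqnorm g0 tau b (torus_df F f tau a u) u)).
  by apply/funext => u; rewrite /K /g derive1n_torus_curv.
by rewrite torus_integralZ // pmulr_rgt0.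
Qed.
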